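(* Consider the linear Gaussian structural equation model with soft interventions described in the context, and assume MMSE estimation of the weights of the edges into node $i$ (under intervention status $a_i$) from the estimated parent set $\widehat{\mathcal P}_i(a_i)$. (1) In the presence of only false positive errors, the estimated edge weights satisfy $$\mathbb E\Bigl[[\widehat{\boldsymbol B}_{\boldsymbol a}^t]_{i,\widehat{\mathcal P}_i(a_i)}\,\Big|\,\boldsymbol X^{1:t}_{\widehat{\mathcal P}_i(a_i)}(a_i)\Bigr]=[\boldsymbol B_{\boldsymbol a}]_{i,\widehat{\mathcal P}_i(a_i)}.$$ (2) In the presence of only false negative errors, the estimated edge weights satisfy $$\mathbb E\Bigl[[\widehat{\boldsymbol B}_{\boldsymbol a}^t]_{i,\widehat{\mathcal P}_i(a_i)}\,\Big|\,\boldsymbol X^{1:t}_{\widehat{\mathcal P}_i(a_i)}(a_i)\Bigr]=[\boldsymbol B_{\boldsymbol a}]_{i,\widehat{\mathcal P}_i(a_i)}+\Bigl[\boldsymbol X^{1:t}_{\widehat{\mathcal P}_i(a_i)}(a_i)\,\boldsymbol X^{1:t}_{\widehat{\mathcal P}_i(a_i)}(a_i)^{\top}\Bigr]^{-1}\mathbb E\Bigl[\boldsymbol X^{1:t}_{\widehat{\mathcal P}_i(a_i)}(a_i)\,\boldsymbol X^{1:t}_{\mathcal P_i\backslash\widehat{\mathcal P}_i(a_i)}(a_i)^{\top}\,\Big|\,\boldsymbol X^{1:t}_{\widehat{\mathcal P}_i(a_i)}(a_i)\Bigr][\boldsymbol B_{\boldsymbol a}]_{i,\mathcal P_i\backslash\widehat{\mathcal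 P}_i(a_i)}.$$
   Context: Model. The nodes are $\{1,\dots,N\}$. There are an observational weight matrix $\boldsymbol B\in\mathbb R^{N\times N}$ and an interventional weight matrix $\boldsymbol B'\in\mathbb R^{N\times N}$; the $(k,i)$ entry is the weight of the directed edge $k\to i$. For an intervention $\boldsymbol a\in\{0,1\}^N$, the post-intervention matrix $\boldsymbol B_{\boldsymbol a}$ has $i$-th column equal to the $i$-th column of $\boldsymbol B'$ if $a_i=1$ and of $\boldsymbol B$ if $a_i=0$. The causal graphs are directed acyclic graphs. The parent set $\mathcal P_i(a_i)$ of node $i$ is the set of $k$ with an edge $k\to i$ in the graph of $\boldsymbol B_{\boldsymbol a}$. Under intervention $\boldsymbol a$ the vector of node values satisfies $\boldsymbol x=\boldsymbol B_{\boldsymbol a}^\top\boldsymbol x+\boldsymbol\epsilon$, where $\boldsymbol\epsilon$ is a vector of independent Gaussian exogenous variables with known means $\boldsymbol\nu$ and unknown variances $\boldsymbol\sigma^2$. At each step $\tau$ an agent selects an intervention $\boldsymbol a^\tau$ and observes $\boldsymbol x^\tau$ generated by this model; the randomness of the observations comes from the exogenous variables, which are independent of the intervention. Write $\boldsymbol X^{1:t}=(\boldsymbol x^1,\dots,\boldsymbol x^t)\in\mathbb R^{N\times t}$. Notation. $\widehat{\mathcal P}_i(a_i)$ is the estimated parent set of node $i$ (the nodes declared to be parents of $i$ on the basis of the observed data), and $\mathcal P_i\backslash\widehat{\mathcal P}_i(a_i)$ is the set difference $\mathcal P_i(a_i)\setminus\widehat{\mathcal P}_i(a_i)$. For a node set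 $S$, $\boldsymbol X^{1:t}_S(a_i)$ denotes the observed values of the nodes in $S$ up to step $t$, restricted to the steps at which node $i$ has intervention status $a_i$ (rows indexed by $S$, columns by steps). $[\boldsymbol B_{\boldsymbol a}]_{i,S}$ is the vector of those entries of the $i$-th column of $\boldsymbol B_{\boldsymbol a}$ that are indexed by $k\in S$, i.e. the weights of the edges $k\to i$, and similarly for $\widehat{\boldsymbol B}_{\boldsymbol a}^t$. Estimator. With $\boldsymbol Z=\boldsymbol X^{1:t}_{\widehat{\mathcal P}_i(a_i)}(a_i)$, the MMSE estimate is $[\widehat{\boldsymbol B}_{\boldsymbol a}^t]_{i,\widehat{\mathcal P}_i(a_i)}=(\boldsymbol Z\boldsymbol Z^\top)^{-1}\boldsymbol Z\,(\boldsymbol X_i^{1:t}(a_i)-\nu_i\boldsymbol 1^\top)^\top$, where $\boldsymbol 1$ is the all-ones vector. Errors. A false positive error is an edge in the estimated graph that is not present in the true graph; a false negative error is an edge present in the true graph that is absent from the estimated graph. For the edges into node $i$, only false positive errors means $\mathcal P_i(a_i)\subset\widehat{\mathcal P}_i(a_i)$, and only false negative errors means $\widehat{\mathcal P}_i(a_i)\subset\mathcal P_i(a_i)$.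
   Formalization: The estimated parent set is fixed, not data-selected; interventions are jointly independent of all exogenous variables; in (1) replacing the parents of i by the estimated set must keep every graph with status a_i acyclic (no descendant of i declared a parent), else the claim fails. *)

(* Defs.v *)
From HB Require Import structures.
From mathcomp Require Import all_boot all_order all_algebra.
From mathcomp Require Import all_classical all_reals all_analysis.

Set Implicit Arguments.
Unset Strict Implicit.
Unset Printing Implicit Defensive.

Import Order.TTheory GRing.Theory Num.Theory.
Import numFieldNormedType.Exports.

Local Open Scope classical_set_scope.
Local Open Scope ring_scope.

Section Graphs.
Context {R : realType} {N : nat}.

(* The (k, i) entry of a weight matrix is the weight of the edge k -> i; there
   is an edge when this weight is nonzero. *)
Definition edge (W : 'M[R]_N) : rel 'I_N := fun k i => W k i != 0.

(* A cycle [:: v_1; ...; v_n] closes up with the edge v_n -> v_1, so n = 1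
   covers self-loops. *)
Definition acyclic (V : finType) (e : rel V) : Prop :=
  forall p : seq V, p != [::] -> ~~ cycle e p.

Definition post_intervention (B B' : 'M[R]_N) (a : 'I_N -> bool) : 'M[R]_N :=
  \matrix_(k, i) (if a i then B' k i else B k i).

Definition parents (W : 'M[R]_N) (i : 'I_N) : {set 'I_N} :=
  [set k | edge W k i]%SET.

(* The graph of W with the parents of i replaced by S. If it is acyclic, then S
   contains neither i nor a descendant of i, whose values would depend on the
   exogenous variable of i. *)
Definition set_parents (W : 'M[R]_N) (i : 'I_N) (S : {set 'I_N}) : rel 'I_N :=
  fun k j => if j == i then k \in S else edge W k j.

Definition weights_into (W : 'M[R]_N) (i : 'I_N) (S : {set 'I_N}) :
    'cV[R]_#|S| :=
  \col_p W (enum_val p) i.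

End Graphs.

Section Estimator.
Context {R : realType} {N t : nat}.

(* Column tau of X is the observation at step tau; the rows of the restriction
   are indexed by the nodes in S and its columns by the steps in D. *)
Definition data (X : 'M[R]_(N, t)) (S : {set 'I_N}) (D : {set 'I_t}) :
    'M[R]_(#|S|, #|D|) :=
  \matrix_(p, q) X (enum_val p) (enum_val q).

Definition node_data (X : 'M[R]_(N, t)) (i : 'I_N) (D : {set 'I_t}) :
    'rV[R]_#|D| :=
  \row_q X i (enum_val q).

Definition gram (X : 'M[R]_(N, t)) (S : {set 'I_N}) (D : {set 'I_t}) :
    'M[R]_#|S| :=
  data X S D *m (data X S D)^T.

Definition mmse (nu : 'I_N -> R) (X : 'M[R]_(N, t)) (i : 'I_N)
    (S : {set 'I_N}) (D : {set 'I_t}) : 'cV[R]_#|S| :=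
  invmx (gram X S D) *m data X S D *m (node_data X i D - const_mx (nu i))^T.

End Estimator.

Section Randomness.
Context d (T : measurableType d) (R : realType) (P : probability T R).

(* Y is a version of the conditional expectation of X given <<s C>>. It is the
   usual notion when X is integrable (take F n = setT); in general X need only
   be integrable on each set of a countable cover by <<s C>>-measurable sets.
   This generality is needed because the least-squares estimate can fail to be
   integrable: with one regressor and one sample it is a ratio of Gaussians. *)
Definition is_cond_exp (C : set (set T)) (X Y : T -> R) : Prop :=
  measurable_fun [set: g_sigma_algebraType C] (Y : g_sigma_algebraType C -> R) /\
  exists F : (set T)^nat,
    [/\ forall n, <<s C >> (F n),
        \bigcup_n F n = [set: T],
        forall n, P.-integrable (F n) (EFin \o X)
      & forall n (A : set T), <<s C >> A -> A `<=` F n ->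
          (\int[P]_(w in A) (X w)%:E = \int[P]_(w in A) (Y w)%:E)%E].

Definition is_cond_exp_mx (m n : nat) (C : set (set T))
    (X Y : T -> 'M[R]_(m, n)) : Prop :=
  forall p q, is_cond_exp C (fun w => X w p q) (fun w => Y w p q).

Definition mutually_independent (I : finType) (F : I -> set (set T)) : Prop :=
  forall (J : {set I}) (E : I -> set T), (forall j, j \in J -> F j (E j)) ->
    P (\bigcap_(j in [set` J]) E j) = (\prod_(j in J) P (E j))%E.

Context {N t : nat}.

(* None is the sigma-algebra of the whole intervention sequence, Some (tau, k)
   that of the exogenous variable of node k at step tau. *)
Definition source_sigma (act : 'I_t -> 'I_N -> {RV P >-> bool})
    (eps : 'I_t -> 'I_N -> {RV P >-> R}) (o : option ('I_t * 'I_N)) :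
    set (set T) :=
  match o with
  | None => <<s [set F | exists tau k (E : set bool), F = act tau k @^-1` E] >>
  | Some (tau, k) => g_sigma_algebra_preimage (eps tau k)
  end.

Definition steps (act : 'I_t -> 'I_N -> {RV P >-> bool}) (i : 'I_N) (c : bool)
    (w : T) : {set 'I_t} :=
  [set tau | act tau i w == c]%SET.

(* Generators of the sigma-algebra of the random matrix data (X w) S (D w),
   whose columns are labelled by steps; E = setT records the selected steps. *)
Definition data_events (X : T -> 'M[R]_(N, t)) (S : {set 'I_N})
    (D : T -> {set 'I_t}) : set (set T) :=
  [set F | exists k tau (E : set R), [/\ k \in S, measurable E
         & F = [set w | tau \in D w /\ E (X w k tau)]]].

(* The Gaussian exogenous variables have mean nu k and variance sigma k ^+ 2
   (normal_prob takes the standard deviation), and are independent across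
   nodes and steps, and of the interventions. *)
Definition linear_sem (B B' : 'M[R]_N) (nu sigma : 'I_N -> R)
    (act : 'I_t -> 'I_N -> {RV P >-> bool})
    (eps : 'I_t -> 'I_N -> {RV P >-> R}) (X : T -> 'M[R]_(N, t)) : Prop :=
  [/\ forall a : 'I_N -> bool, acyclic (edge (post_intervention B B' a)),
      forall k, 0 < sigma k,
      forall tau k (E : set R), measurable E ->
        distribution P (eps tau k) E = normal_prob (nu k) (sigma k) E,
      mutually_independent (source_sigma act eps)
    & forall tau w,
        let Ba := post_intervention B B' (fun k => act tau k w) in
        col tau (X w) = Ba^T *m col tau (X w) + \col_k eps tau k w].

End Randomness.

(* Main.v *)
Require Import Defs.
From HB Require Import structures.
From mathcomp Require Import all_boot all_order all_algebra.
From mathcomp Require Import all_classical all_reals all_analysis.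
From mathcomp Require Import measurable_realfun.
From mathcomp Require Import ring lra.

(* Let Z be the data of the estimated parents and Z' those of the missed ones.
   Substituting the structural equation of node i into the estimator gives
     Bhat = (Z Z^T)^-1 (Z Z^T) b + (Z Z^T)^-1 (Z Z'^T) b'
            + (Z Z^T)^-1 Z (eps_i - nu_i)
   on the selected steps. The first term is almost surely b. In the other two the
   factors built from Z are pulled out of the conditional expectation. Acyclicity
   makes Z a function of the interventions and of exogenous variables other than
   that of node i at the given step, so eps_i - nu_i is independent of Z and, being
   centered, leaves no contribution. Part (1) is the case where no parent is missed. *)

Set Implicit Arguments.
Unset Strict Implicit.
Unset Printing Implicit Defensive.

Import Order.TTheory GRing.Theory Num.Theory.
Import numFieldNormedType.Exports.
Import HBNNSimple.

Local Open Scope classical_set_scope.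
Local Open Scope ring_scope.

(** Two obstacles shape the proof. The estimator need not be integrable, so the rules for
    conditional expectations are proved on countable covers whose pieces bound the factors to be
    pulled out. And the number of selected steps is random, so the matrix products are rewritten as
    sums over all steps, with unselected entries set to 0; only then can linearity and pull-out be
    applied term by term. In part (1) a false positive could be a descendant of i; acyclicity of the
    graph with the estimated parents excludes it. In part (2) that acyclicity is inherited from the
    true graph. *)

(** * Conditional expectations on countable covers *)

Section CondExp.
Context d (T : measurableType d) (R : realType) (P : probability T R).
Variable C : set (set T).
Hypothesis mC : C `<=` measurable.

Let measurable_gen (A : set T) : <<s C >> A -> measurable A.
Proof. exact: (smallest_sub (@sigma_algebra_measurable _ T) mC). Qed.

Let gen_setI (A B : set T) : <<s C >> A -> <<s C >> B -> <<s C >> (A `&` B).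
Proof. exact: (@measurableI _ (g_sigma_algebraType C)). Qed.

Let measurable_fun_gen d' (U : measurableType d') (Y : T -> U) :
  measurable_fun [set: g_sigma_algebraType C] (Y : g_sigma_algebraType C -> U) ->
  measurable_fun [set: T] Y.
Proof. by move=> mY _ B mB; apply: measurable_gen; exact: mY. Qed.

(** [g] is a limit of simple functions built on [g_sigma_algebraType C], so that their level sets
    lie in [<<s C>>]. On each level set [D] integrates to 0, and [K |D|] dominates the limit. *)
Lemma integral_mul_eq0_ge0 (A : set T) (D : T -> R) (g : T -> R) (K : R) :
  <<s C >> A -> P.-integrable A (EFin \o D) ->
  (forall B, <<s C >> B -> B `<=` A -> (\int[P]_(w in B) (D w)%:E = 0)%E) ->
  measurable_fun [set: g_sigma_algebraType C] (g : g_sigma_algebraType C -> R) ->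
  (forall w, A w -> 0 <= g w <= K) ->
  (\int[P]_(w in A) (g w * D w)%:E = 0)%E.
Proof.
move=> CA iD D0 mg gK.
have mA := measurable_gen CA.
have mDA : measurable_fun A D by apply/measurable_EFinP; case/integrableP : iD.
have mgE : measurable_fun (A : set (g_sigma_algebraType C))
    (EFin \o (g : g_sigma_algebraType C -> R)).
  by apply/measurable_EFinP; exact: (measurable_funTS mg).
have mA' : measurable (A : set (g_sigma_algebraType C)) := CA.
pose H := nnsfun_approx mA' mgE.
pose h n : T -> R := (H n : g_sigma_algebraType C -> R).
have g0 w : A w -> (0 <= (EFin \o g) w)%E by move=> /gK/andP[]; rewrite lee_fin.
have hg n w : A w -> 0 <= h n w <= g w.
  move=> Aw; apply/andP; split; first by rewrite /h; exact: fun_ge0.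
  rewrite -lee_fin [h n w](_ : _ = approx A (EFin \o g) n w).
    exact: le_approx.
  by rewrite /h /H nnsfun_approxE.
have mh n : measurable_fun A (h n).
  by apply: measurable_funTS; apply: measurable_fun_gen;
    exact: (measurable_funP (H n)).
have hn0 n : (\int[P]_(w in A) (h n w * D w)%:E = 0)%E.
  have [m [c hE]] : exists m (c : 'I_m -> R), forall w,
      h n w = \sum_(j < m) c j * \1_(h n @^-1` [set c j]) w.
    by eexists; eexists => w; exact: (fimfunEord (H n) w).
  have mlev r : <<s C >> (h n @^-1` [set r]).
    rewrite -[X in <<s C >> X](setTI).
    exact: (measurable_funP (H n) measurableT _ (measurable_set1 r)).
  under eq_integral => w _.
    rewrite hE mulr_suml -sumEFin.
    under eq_bigr => j _ do rewrite -mulrA EFinM.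
    over.
  have mI r : measurable_fun A (\1_(h n @^-1` [set r]) : T -> R).
    by apply: measurable_funTS; apply: measurable_indic; exact: measurable_gen.
  have iI r : P.-integrable A (fun w => (\1_(h n @^-1` [set r]) w * D w)%:E).
    apply: (le_integrable mA _ _ iD) => /=.
      by apply/measurable_EFinP; apply: measurable_funM.
    move=> w Aw /=; rewrite lee_fin normrM ler_piMl//.
    by rewrite indicE; case: (_ \in _); rewrite ?normr1 ?normr0.
  rewrite integral_sum//=; last by move=> j; apply: integrableZl.
  rewrite big1// => j _; rewrite integralZl//.
  under eq_integral do rewrite EFinM muleC.
  rewrite (eq_integral ((EFin \o D) \_ (h n @^-1` [set c j]))); last first.
    by move=> w _; rewrite epatch_indic.
  rewrite -integral_mkcondr.
  rewrite D0 ?mule0//.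
  by apply: (@measurableI _ (g_sigma_algebraType C)) => //; exact: mlev.
have [|||||_ _] := @dominated_convergence _ T R P A mA
  (fun n w => (h n w * D w)%:E) (fun w => (g w * D w)%:E)
  (fun w => (K%:E * `|(D w)%:E|)%E).
- by move=> n; apply/measurable_EFinP; apply: measurable_funM.
- apply/measurable_EFinP; apply: measurable_funM => //.
  by apply: measurable_funTS; exact: measurable_fun_gen.
- apply: aeW => w Aw; apply/fine_cvgP; split; first exact: nearW.
  apply: cvgMl; have /fine_cvgP[_] := cvg_nnsfun_approx mA' mgE g0 Aw; exact.
- by apply: integrableZl => //; exact: (integrable_abse iD).
- apply: aeW => w n Aw; rewrite lee_fin normrM ler_wpM2r//.
  have /andP[h0 hle] := hg n w Aw; rewrite ger0_norm//.
  by rewrite (le_trans hle)//; case/andP : (gK w Aw).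
rewrite [X in X @ \oo](_ : _ = cst 0%E); last exact/funext.
by move=> /(cvg_unique (@ereal_hausdorff R)) /(_ (cvg_cst _)).
Qed.


Lemma integrable_bounded_mul (A : set T) (X g : T -> R) (K : R) :
  measurable A -> P.-integrable A (EFin \o X) -> measurable_fun A g ->
  (forall w, A w -> `|g w| <= K) ->
  P.-integrable A (EFin \o (fun w => g w * X w)).
Proof.
move=> mA iX mg gK.
have mX : measurable_fun A X by apply/measurable_EFinP; case/integrableP : iX.
apply: (@le_integrable _ _ _ _ A mA _ (fun w => (K%:E * (X w)%:E)%E)).
- by apply/measurable_EFinP; apply: measurable_funM.
- move=> w Aw /=; rewrite lee_fin !normrM ler_wpM2r//.
  by rewrite (le_trans (gK w Aw))// ler_norm.
- exact: integrableZl.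
Qed.

Lemma integral_mul_eq0 (A : set T) (D : T -> R) (g : T -> R) (K : R) :
  <<s C >> A -> P.-integrable A (EFin \o D) ->
  (forall B, <<s C >> B -> B `<=` A -> (\int[P]_(w in B) (D w)%:E = 0)%E) ->
  measurable_fun [set: g_sigma_algebraType C] (g : g_sigma_algebraType C -> R) ->
  (forall w, A w -> `|g w| <= K) ->
  (\int[P]_(w in A) (g w * D w)%:E = 0)%E.
Proof.
move=> CA iD D0 mg gK.
have mA := measurable_gen CA.
have mgT := measurable_fun_gen mg.
(* Adding [K] makes the factor nonnegative and bounded by [2K]; the correction [K D] integrates to 0
   on [A] itself. *)
have mgK : measurable_fun [set: g_sigma_algebraType C]
    (fun w : g_sigma_algebraType C => (g w + K : R)).
  exact: measurable_funD.
have gK0 w : A w -> 0 <= g w + K <= K + K.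
  by move=> /gK; rewrite ler_norml lerD2r => /andP[? ->]; rewrite -lerBlDr sub0r andbT.
under eq_integral => w _.
  rewrite [X in X%:E](_ : _ = (g w + K) * D w - K * D w); last first.
    by rewrite mulrDl addrK.
  rewrite EFinB; over.
rewrite integralB//=; last 2 first.
- apply: (@integrable_bounded_mul _ _ _ (K + K)) => //.
    by apply: measurable_funTS; apply: measurable_funD.
  by move=> w /gK0/andP[g0 gle]; rewrite ger0_norm.
- exact: (@integrable_bounded_mul _ _ (cst K) `|K|).
rewrite (integral_mul_eq0_ge0 CA iD D0 mgK gK0) sub0e.
under eq_integral do rewrite EFinM.
by rewrite integralZl// D0// mule0 oppe0.
Qed.

(** A countable index type allows covers indexed by pairs, as when two covers are intersected.
    Numbers that code no index receive the empty set. *)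
Lemma cond_exp_cover (I : countType) (F : I -> set T) (X Y : T -> R) :
  measurable_fun [set: g_sigma_algebraType C] (Y : g_sigma_algebraType C -> R) ->
  (forall i, <<s C >> (F i)) -> (forall w, exists i, F i w) ->
  (forall i, P.-integrable (F i) (EFin \o X)) ->
  (forall i A, <<s C >> A -> A `<=` F i ->
    (\int[P]_(w in A) (X w)%:E = \int[P]_(w in A) (Y w)%:E)%E) ->
  is_cond_exp P C X Y.
Proof.
move=> mY CF covF iF eqF; split=> //.
exists (fun n => if unpickle n is Some i then F i else set0); split.
- move=> n; case: (unpickle n) => [i|]; first exact: CF.
  exact: (@measurable0 _ (g_sigma_algebraType C)).
- rewrite -subTset => w _; have [i Fiw] := covF w.
  by exists (pickle i) => //=; rewrite pickleK.
- move=> n; case: (unpickle n) => [i|]; first exact: iF.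
  exact: integrable_set0.
- move=> n A CA; case: (unpickle n) => [i|]; first exact: eqF.
  by rewrite subset0 => ->; rewrite !integral_set0.
Qed.

Lemma measurable_gen_le (g : T -> R) (K : R) :
  measurable_fun [set: g_sigma_algebraType C] (g : g_sigma_algebraType C -> R) ->
  <<s C >> [set w | `|g w| <= K].
Proof.
move=> mg.
have mn : measurable_fun [set: g_sigma_algebraType C]
    (fun w : g_sigma_algebraType C => `|g w|) by exact: measurableT_comp.
have := mn measurableT _ (@measurable_itv _ `]-oo, K]).
by rewrite setTI; congr (<<s C >> _); apply/seteqP; split=> w /=; rewrite in_itv.
Qed.

(** The pieces of the given cover are cut where [|Y|] and [|g|] are at most [n]. The cut by [|Y|]
    makes [Y] integrable on each piece, which [is_cond_exp] does not state. *)
Lemma cond_exp_bounded_cover (X Y g : T -> R) :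
  is_cond_exp P C X Y ->
  measurable_fun [set: g_sigma_algebraType C] (g : g_sigma_algebraType C -> R) ->
  exists2 F : nat * nat -> set T,
    [/\ forall i, <<s C >> (F i), forall w, exists i, F i w,
        forall i, P.-integrable (F i) (EFin \o X) &
        forall i, P.-integrable (F i) (EFin \o Y)] &
    (forall i w, F i w -> `|g w| <= i.2%:R) /\
    forall i A, <<s C >> A -> A `<=` F i ->
      (\int[P]_(w in A) (X w)%:E = \int[P]_(w in A) (Y w)%:E)%E.
Proof.
move=> [mY [F [CF covF iF eqF]]] mg.
pose B n := [set w | `|Y w| <= n%:R] `&` [set w | `|g w| <= n%:R].
have CB n : <<s C >> (B n).
  by apply: gen_setI; exact: measurable_gen_le.
have CFB i : <<s C >> (F i.1 `&` B i.2).
  exact: gen_setI.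
exists (fun i => F i.1 `&` B i.2); split.
- exact: CFB.
- move=> w; have [m _ Fmw] : (\bigcup_n F n) w by rewrite covF.
  have [n hn] : exists n, `|Y w| + `|g w| <= n%:R.
    by exists (Num.bound (`|Y w| + `|g w|)); rewrite ltW// archi_boundP// addr_ge0.
  by exists (m, n); split=> //; split=> /=; apply: le_trans hn;
    rewrite ?lerDl ?lerDr.
- move=> i; apply: integrableS (iF i.1) => //; try exact: measurable_gen.
- move=> i; have mi := measurable_gen (CFB i).
  apply: (@le_integrable _ _ _ _ _ mi _ (cst (i.2%:R)%:E)).
  + by apply/measurable_EFinP/measurable_funTS; exact: measurable_fun_gen.
  + by move=> w [_ [Yw _]] /=; rewrite lee_fin (le_trans Yw)// ler_norm.
  + by apply: finite_measure_integrable_cst.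
- by move=> i w [_ []].
- by move=> i A CA AF; apply: eqF CA _; apply: subset_trans AF _; exact: subIsetl.
Qed.

(** On a piece where [g] is bounded, [X - Y] integrates to 0 over every conditioning event, hence so
    does [g (X - Y)]. *)
Lemma is_cond_expM (X Y g : T -> R) :
  is_cond_exp P C X Y ->
  measurable_fun [set: g_sigma_algebraType C] (g : g_sigma_algebraType C -> R) ->
  is_cond_exp P C (fun w => g w * X w) (fun w => g w * Y w).
Proof.
move=> XY mg; have [F [CF covF iX iY] [gF eqF]] := cond_exp_bounded_cover XY mg.
have mgT := measurable_fun_gen mg.
have iM i A Z : <<s C >> A -> A `<=` F i -> P.-integrable (F i) (EFin \o Z) ->
    P.-integrable A (EFin \o (fun w => g w * Z w)).
  move=> CA AF iZ; apply: (@integrable_bounded_mul _ _ _ i.2%:R).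
  - exact: measurable_gen.
  - by apply: integrableS iZ => //; exact: measurable_gen.
  - exact: measurable_funTS.
  - by move=> w /AF /gF.
have iS i A Z : <<s C >> A -> A `<=` F i -> P.-integrable (F i) (EFin \o Z) ->
    P.-integrable A (EFin \o Z).
  by move=> CA AF iZ; apply: integrableS iZ => //; exact: measurable_gen.
apply: (@cond_exp_cover _ F) => //.
- by apply: measurable_funM => //; case: XY.
- by move=> i; exact: (iM i).
- move=> i A CA AF.
  have mA := measurable_gen CA.
  have fY : (\int[P]_(w in A) (g w * Y w)%:E)%E \is a fin_num.
    by apply: integrable_fin_num => //; exact: (iM i).
  rewrite -[LHS](subeK _ fY) -[RHS]add0e; congr (_ + _)%E.
  rewrite -integralB//; [|exact: (iM i)..].
  under eq_integral do rewrite /= -EFinB -mulrBr.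
  apply: (@integral_mul_eq0 A (fun w => X w - Y w) g i.2%:R) => //.
  + rewrite (_ : _ \o _ = ((EFin \o X) \- (EFin \o Y))%E); last first.
      by apply/funext => w /=; rewrite EFinB.
    by apply: integrableB => //; exact: (iS i).
  + move=> B CB BA; have BF := subset_trans BA AF.
    have mB := measurable_gen CB.
    under eq_integral do rewrite EFinB.
    rewrite integralB//; [|exact: (iS i)..].
    rewrite (eqF i)// subee// integrable_fin_num//; exact: (iS i).
  + by move=> w /AF /gF.
Qed.

Lemma is_cond_expD (X Y X' Y' : T -> R) :
  is_cond_exp P C X Y -> is_cond_exp P C X' Y' ->
  is_cond_exp P C (fun w => X w + X' w) (fun w => Y w + Y' w).
Proof.
move=> XY XY'.
(* The slot of the bounded factor is filled with [Y] itself: only integrability on the pieces is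
   wanted. *)
have [F [CF covF iX iY] [_ eqF]] := cond_exp_bounded_cover XY XY.1.
have [F' [CF' covF' iX' iY'] [_ eqF']] := cond_exp_bounded_cover XY' XY'.1.
have CI i : <<s C >> (F i.1 `&` F' i.2).
  exact: gen_setI.
have iS A E Z : <<s C >> A -> <<s C >> E -> A `<=` E ->
    P.-integrable E (EFin \o Z) -> P.-integrable A (EFin \o Z).
  by move=> CA CE AE iZ; apply: integrableS iZ => //; exact: measurable_gen.
apply: (@cond_exp_cover _ (fun i => F i.1 `&` F' i.2)) => //.
- by apply: measurable_funD; [case: XY|case: XY'].
- by move=> w; have [i Fi] := covF w; have [j Fj] := covF' w; exists (i, j).
- move=> i; have mi := measurable_gen (CI i).
  rewrite (_ : _ \o _ = ((EFin \o X) \+ (EFin \o X'))%E); last first.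
    by apply/funext => w /=; rewrite EFinD.
  apply: integrableD => //.
    by apply: iS (iX i.1) => //; exact: subIsetl.
  by apply: iS (iX' i.2) => //; exact: subIsetr.
- move=> i A CA AF; have mA := measurable_gen CA.
  have AF1 : A `<=` F i.1 by apply: subset_trans AF _; exact: subIsetl.
  have AF2 : A `<=` F' i.2 by apply: subset_trans AF _; exact: subIsetr.
  under eq_integral do rewrite EFinD.
  under [RHS]eq_integral do rewrite EFinD.
  rewrite !integralD//; first by rewrite (eqF i.1)// (eqF' i.2).
  + by apply: iS (iY i.1).
  + by apply: iS (iY' i.2).
  + by apply: iS (iX i.1).
  + by apply: iS (iX' i.2).
Qed.

(** For the term [(Z Z^T)^-1 (Z Z^T) b], equal to [b] where the Gram matrix is invertible. [X]
    inherits its integrability on the pieces from [Y]. *)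
Lemma is_cond_exp_ae (X Y : T -> R) :
  measurable_fun [set: T] X ->
  measurable_fun [set: g_sigma_algebraType C] (Y : g_sigma_algebraType C -> R) ->
  {ae P, forall w, X w = Y w} -> is_cond_exp P C X Y.
Proof.
move=> mX mY XY; have mYT := measurable_fun_gen mY.
have XYA A : ae_eq P A (EFin \o X) (EFin \o Y).
  by apply: filterS XY => w /= -> _.
have mB n : <<s C >> [set w | `|Y w| <= n%:R] by exact: measurable_gen_le.
apply: (@cond_exp_cover _ (fun n : nat => [set w | `|Y w| <= n%:R])) => //.
- move=> w; exists (Num.bound (`|Y w|)).
  by rewrite /= ltW// archi_boundP.
- move=> n; have mn := measurable_gen (mB n).
  have mXn : measurable_fun [set w | `|Y w| <= n%:R] (EFin \o X).
    by apply/measurable_EFinP/measurable_funTS.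
  suff /integrableP[mYn iY] : P.-integrable [set w | `|Y w| <= n%:R] (EFin \o Y).
    apply/integrableP; split=> //; apply: le_lt_trans iY.
    rewrite le_eqVlt; apply/orP; left; apply/eqP.
    apply: ae_eq_integral => //; try exact: measurableT_comp.
    by apply: filterS XY => w /= -> _.
  apply: (@le_integrable _ _ _ _ _ mn _ (cst (n%:R)%:E)).
  + by apply/measurable_EFinP/measurable_funTS.
  + by move=> w Yw /=; rewrite lee_fin (le_trans Yw)// ler_norm.
  + by apply: finite_measure_integrable_cst.
- move=> n A CA AF; apply: ae_eq_integral => //; first exact: measurable_gen.
  + by apply/measurable_EFinP/measurable_funTS.
  + by apply/measurable_EFinP/measurable_funTS.
Qed.

Lemma is_cond_exp_self (Y : T -> R) :
  measurable_fun [set: g_sigma_algebraType C] (Y : g_sigma_algebraType C -> R) ->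
  is_cond_exp P C Y Y.
Proof.
by move=> mY; apply: is_cond_exp_ae => //; [exact: measurable_fun_gen|exact: aeW].
Qed.

Lemma is_cond_exp_sum (I : Type) (s : seq I) (X Y : I -> T -> R) :
  (forall i, is_cond_exp P C (X i) (Y i)) ->
  is_cond_exp P C (fun w => \sum_(i <- s) X i w) (fun w => \sum_(i <- s) Y i w).
Proof.
move=> XY; elim: s => [|i s IHs].
  under eq_fun do rewrite big_nil.
  under [X in is_cond_exp _ _ _ X]eq_fun do rewrite big_nil.
  exact: is_cond_exp_self.
under eq_fun do rewrite big_cons.
under [X in is_cond_exp _ _ _ X]eq_fun do rewrite big_cons.
exact: is_cond_expD.
Qed.


(** The witness is the Radon-Nikodym derivative of the charge given by the integrals of [X], with
    respect to [P], both restricted to [<<s C>>]. The restriction of [P] is the distribution of the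
    identity map into [TC]. *)
Lemma cond_exp_exists (X : T -> R) :
  P.-integrable [set: T] (EFin \o X) -> exists Y, is_cond_exp P C X Y.
Proof.
move=> iX.
pose TC := g_sigma_algebraType C.
have mid : measurable_fun [set: T] (id : T -> TC).
  by move=> _ B mB; rewrite setTI preimage_id; exact: measurable_gen.
pose J : {mfun T >-> TC} := HB.pack (id : T -> TC) (isMeasurableFun.Build _ _ _ _ _ mid).
pose nu := induced_charge iX.
pose nuC : set TC -> \bar R := nu.
have nu0 : nuC set0 = 0%E by exact: charge0.
have nufin A : measurable A -> nuC A \is a fin_num.
  by move=> /measurable_gen mA; exact: fin_num_measure.
have nuadd : semi_sigma_additive nuC.
  move=> F mF tF mUF; apply: (@charge_semi_sigma_additive _ _ _ nu) => //.
    by move=> n; exact: (measurable_gen (mF n)).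
  exact: (measurable_gen mUF).
pose chC := isCharge.Build _ TC R nuC nu0 nufin nuadd.
pose nuch : {charge set TC -> \bar R} := HB.pack nuC chC.
have dom : nuch `<< distribution P J.
  apply/null_content_dominatesP => A mA PA0; apply: null_set_integral => //.
  - exact: measurable_gen.
  - by apply: measurable_funTS; exact: (measurable_int P).
pose f := Radon_Nikodym nuch (distribution P J).
have ff x : f x \is a fin_num by exact: Radon_Nikodym_fin_num.
have fi := Radon_Nikodym_integrable dom.
have fE : EFin \o (fine \o f) = f by apply/funext => x /=; rewrite fineK.
have mf : measurable_fun [set: TC] (fine \o f : TC -> R).
  by apply/measurable_EFinP; rewrite fE; exact: measurable_int fi.
exists (fine \o f); split=> //; exists (fun=> [set: T]); split=> //.
- by move=> _; exact: (@measurableT _ TC).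
- by rewrite bigcup_const//; exists 0%N.
have iP : P.-integrable [set: T] (EFin \o (fine \o f)).
  have mfE : measurable_fun [set: TC] (EFin \o (fine \o f)) by exact/measurable_EFinP.
  apply/integrableP; split; first exact: measurable_fun_gen.
  have /integrableP[_] := fi; rewrite -/f -fE.
  rewrite ge0_integral_pushforward//.
  exact: measurableT_comp.
move=> n A CA _; rewrite -[LHS]/(nuch A) (Radon_Nikodym_integral dom)//.
transitivity (\int[distribution P J]_(x in A) (EFin \o (fine \o f)) x)%E.
  by rewrite fE.
rewrite integral_pushforward//; first exact/measurable_EFinP.
by apply: integrableS iP => //; exact: measurable_gen.
Qed.

End CondExp.

(** * First moments of the normal distribution *)

Section Normal.
Context {R : realType}.
Local Notation mu := (@lebesgue_measure R).
Implicit Types m s : R.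

(** The change of variables produces an abstract Radon-Nikodym derivative; it agrees almost
    everywhere with [normal_pdf], both having the same integral over every measurable set. *)
Lemma ge0_integral_normal_prob m s (f : R -> R) :
  measurable_fun [set: R] f -> (forall x, 0 <= f x) ->
  (\int[normal_prob m s]_x (f x)%:E =
   \int[mu]_x ((f x)%:E * (normal_pdf m s x)%:E))%E.
Proof.
move=> mf f0.
have dom := @normal_prob_dominates R m s.
have mfE : measurable_fun [set: R] (EFin \o f) by apply/measurable_EFinP.
rewrite -(Radon_Nikodym_SigmaFinite.change_of_variables dom (f := EFin \o f))//.
set g := Radon_Nikodym_SigmaFinite.f _ _.
have ig : mu.-integrable [set: R] g by exact: Radon_Nikodym_SigmaFinite.f_integrable.
have mp : measurable_fun [set: R] (fun x => (normal_pdf m s x)%:E).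
  by apply/measurable_EFinP; exact: measurable_normal_pdf.
apply: ae_eq_integral => //.
- by apply: emeasurable_funM => //; exact: measurable_int ig.
- exact: emeasurable_funM.
- apply: ae_eqe_mul2l; apply: integral_ae_eq => //.
  by move=> E _ mE; rewrite -Radon_Nikodym_SigmaFinite.f_integral.
Qed.

Lemma normal_pdf_shift m s x : s != 0 -> normal_pdf m s (x + m) = normal_pdf 0 s x.
Proof. by move=> s0; rewrite !normal_pdfE// /normal_fun addrK subr0. Qed.

Lemma normal_pdf_opp s x : s != 0 -> normal_pdf 0 s (- x) = normal_pdf 0 s x.
Proof. by move=> s0; rewrite !normal_pdfE// /normal_fun !subr0 sqrrN. Qed.

(** A wider Gaussian density absorbs the factor [|x|], so the first absolute moment is bounded by a
    multiple of the mass of a density. *)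
Lemma le_norm_normal_pdf s : s != 0 -> exists K, forall x,
  `|x| * normal_pdf 0 s x <= K * normal_pdf 0 (2 * s) x.
Proof.
move=> s0; have s20 : 2 * s != 0 by rewrite mulf_neq0// pnatr_eq0.
(* [c = 1/(2 s^2) - 1/(8 s^2)] is the gap between the two Gaussian exponents. *)
pose c : R := 3 / (8 * s ^+ 2).
have c0 : 0 < c by rewrite divr_gt0// mulr_gt0// exprn_even_gt0.
(* The quotient of peaks exchanges the normalizing constants; [1 + c^-1] bounds
   [(1 + x^2) exp (- c x^2)], because [(1 + c x^2) exp (- c x^2) <= 1]. *)
exists (normal_peak s / normal_peak (2 * s) * (1 + c^-1)) => x.
rewrite !normal_pdfE// /normal_fun !subr0.
have -> : - x ^+ 2 / (s ^+ 2 *+ 2) = - (c * x ^+ 2) + - x ^+ 2 / ((2 * s) ^+ 2 *+ 2).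
  by rewrite /c; field.
rewrite expRD [leRHS](_ : _ = normal_peak s * ((1 + c^-1) *
    expR (- x ^+ 2 / ((2 * s) ^+ 2 *+ 2)))); last first.
  have fE (a b u v : R) : b != 0 -> a / b * u * (b * v) = a * (u * v).
    by move=> b0; field.
  by apply: fE; rewrite gt_eqF// normal_peak_gt0.
rewrite mulrCA; apply: ler_wpM2l; first exact: normal_peak_ge0.
rewrite mulrA; apply: ler_wpM2r; first exact: expR_ge0.
have x1 : `|x| <= 1 + x ^+ 2.
  by rewrite -real_normK ?num_real//; nra.
have e1 : (1 + c * x ^+ 2) * expR (- (c * x ^+ 2)) <= 1.
  by rewrite expRN ler_pdivrMr ?expR_gt0// mul1r expR_ge1Dx.
have e0 : 0 < expR (- (c * x ^+ 2)) by exact: expR_gt0.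
have e2 : expR (- (c * x ^+ 2)) <= 1.
  by rewrite -expR0 ler_expR oppr_le0 mulr_ge0 ?sqr_ge0// ltW.
apply: (le_trans (ler_wpM2r (ltW e0) x1)).
rewrite mulrDl mul1r lerD// -(ler_pM2l c0) mulfV ?gt_eqF// mulrA.
by apply: le_trans e1; rewrite mulrDl mul1r lerDr ltW.
Qed.

Lemma integral_norm_normal_lty s : s != 0 ->
  (\int[mu]_x (`|x| * normal_pdf 0 s x)%:E < +oo)%E.
Proof.
move=> s0; have [K hK] := le_norm_normal_pdf s0.
apply: (@le_lt_trans _ _ (\int[mu]_x (K%:E * (normal_pdf 0 (2 * s) x)%:E))%E).
  apply: ge0_le_integral => //=.
  - by move=> x _; rewrite lee_fin mulr_ge0// normal_pdf_ge0.
  - apply/measurable_EFinP; apply: measurable_funM; last exact: measurable_normal_pdf.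
    exact: normr_measurable.
  - apply/measurable_EFinP; apply: measurable_funM => //; exact: measurable_normal_pdf.
  - by move=> x _; rewrite -EFinM lee_fin.
have inn := integrable_normal_pdf 0 (2 * s).
by rewrite integralZl// integral_normal_pdf mule1 ltry.
Qed.


Let ge0_integral_split (f : R -> R) : (forall x, 0 <= f x) ->
  continuous f ->
  (\int[mu]_x (f x)%:E =
   \int[mu]_(x in `[0%R, +oo[) (f x)%:E + \int[mu]_(x in `]-oo, 0%R]) (f x)%:E)%E.
Proof.
move=> f0 cf.
have mf : measurable_fun [set: R] f by exact: continuous_measurable_fun.
have mposnums : measurable [set x : R | 0 <= x] by rewrite -set_itvcy.
rewrite -[X in integral _ X](setUv [set x : R | 0 <= x]).
rewrite ge0_integral_setU//=; last 4 first.
  exact: measurableC.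
  by apply/measurable_EFinP; rewrite setUv.
  by move=> x _; rewrite lee_fin.
  exact/disj_setPCl.
rewrite -set_itvcy// setCitvr.
by rewrite integral_itv_bndo_bndc//; exact/measurable_EFinP/measurable_funTS.
Qed.

(** After splitting at 0, reflection carries each half-line onto the other. *)
Lemma ge0_integral_opp (f : R -> R) : (forall x, 0 <= f x) -> continuous f ->
  (\int[mu]_x (f x)%:E = \int[mu]_x (f (- x))%:E)%E.
Proof.
move=> f0 cf.
have cfN : continuous (f \o -%R).
  by move=> x; apply: continuous_comp; [exact: opp_continuous|exact: cf].
have half (g : R -> R) : (forall x, 0 <= g x) -> continuous g ->
    (\int[mu]_(x in `]-oo, 0%R]) (g x)%:E = \int[mu]_(x in `[0%R, +oo[) (g (- x))%:E)%E.
  move=> g0 cg; rewrite -[in LHS]oppr0 ge0_integration_by_substitutionNy//.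
  exact: continuous_subspaceT.
rewrite ge0_integral_split// half// [RHS](ge0_integral_split (f := f \o -%R))//.
rewrite (half (f \o -%R))//= addeC; congr (_ + _)%E.
by apply: eq_integral => x _; rewrite opprK.
all: by move=> x /=.
Qed.

Lemma ge0_integral_shift (f : R -> R) (c : R) : (forall x, 0 <= f x) -> continuous f ->
  (\int[mu]_x (f x)%:E = \int[mu]_x (f (x + c))%:E)%E.
Proof.
move=> f0 cf; pose F (x : R^o) : R^o := x + c.
have dF : F^`()%classic = cst 1.
  by apply/funext => x; rewrite derive1E deriveD// derive_cst addr0 derive_id.
rewrite (@increasing_ge0_integration_by_substitutionT _ F f)//.
- by apply: eq_integral => x _ /=; rewrite dF /= mulr1.
- by move=> x y xy; rewrite ltrD2r.
- by rewrite dF => x; exact: cvg_cst.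
- by rewrite dF; exact: is_cvg_cst.
- by rewrite dF; exact: is_cvg_cst.
- exact: cvg_addrr_Ny.
- exact: cvg_addrr.
Qed.

(** This form of the mean involves only integrals of nonnegative functions. Centering followed by
    [x -> - x] exchanges the positive and negative parts of [x - m]. *)
Lemma normal_prob_mean m s : s != 0 ->
  (\int[normal_prob m s]_x (Num.max (x - m) 0)%:E =
   \int[normal_prob m s]_x (Num.max (- (x - m)) 0)%:E)%E /\
  (\int[normal_prob m s]_x (Num.max (x - m) 0)%:E < +oo)%E.
Proof.
move=> s0.
have cmax (g : R -> R) : continuous g -> continuous (fun x => Num.max (g x) 0).
  by move=> cg x; apply: (@continuous_max _ _ g (fun=> 0)); [exact: cg|exact: cvg_cst].
have cpdf m' : continuous (normal_pdf m' s) by exact: continuous_normal_pdf.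
have pos g m' x : 0 <= Num.max (g x) 0 * normal_pdf m' s x :> R.
  by rewrite mulr_ge0// ?normal_pdf_ge0// le_max lexx orbT.
have cB : continuous (fun x : R => x - m).
  by move=> x; apply: (@cvgB _ R^o); [exact: cvg_id|exact: cvg_cst].
have key (g : R -> R) : continuous g ->
    (\int[normal_prob m s]_x (Num.max (g (x - m)) 0)%:E =
     \int[mu]_x (Num.max (g x) 0 * normal_pdf 0 s x)%:E)%E.
  move=> cg; rewrite (ge0_integral_normal_prob _ _ (f := fun x => Num.max (g (x - m)) 0)).
  - under eq_integral do rewrite -EFinM.
    rewrite (@ge0_integral_shift _ m).
    + by apply: eq_integral => x _; rewrite addrK normal_pdf_shift.
    + by move=> x; exact: (pos (fun x => g (x - m))).
    + move=> x; apply: cvgM; last exact: cpdf.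
      by apply: cmax => y; apply: continuous_comp; [exact: cB|exact: cg].
  - apply: continuous_measurable_fun; apply: cmax => y.
    by apply: continuous_comp; [exact: cB|exact: cg].
  - by move=> x; rewrite le_max lexx orbT.
have cid : continuous (fun x : R => x) by move=> x; exact: cvg_id.
have cN : continuous (fun x : R => - x) by exact: opp_continuous.
rewrite (key _ cid) (key _ cN); split.
  rewrite ge0_integral_opp//; first by under eq_integral do rewrite normal_pdf_opp//.
  - by move=> x; exact: (pos id).
  - by move=> x; apply: cvgM; [exact: (cmax id)|exact: cpdf].
apply: le_lt_trans (integral_norm_normal_lty s0).
apply: ge0_le_integral => //=.
- by move=> x _; rewrite lee_fin; exact: (pos id).
- by apply/measurable_EFinP/measurable_funM; [
    exact: continuous_measurable_fun (cmax _ cid)|exact: measurable_normal_pdf].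
- by apply/measurable_EFinP/measurable_funM; [
    exact: normr_measurable|exact: measurable_normal_pdf].
- move=> x _; rewrite lee_fin ler_wpM2r ?normal_pdf_ge0//.
  by rewrite ge_max ler_norm normr_ge0.
Qed.

End Normal.

(** * Independence of the sources and centered Gaussian noise *)

Section Independence.
Context d (T : measurableType d) (R : realType) (P : probability T R).

(* A pi-system generating the joint sigma-algebra of all the sources but o. *)
Definition pi_system_off (I : finType) (F : I -> set (set T)) (o : I) :
    set (set T) :=
  [set A | exists (J : {set I}) (E : I -> set T), [/\ o \notin J,
     forall j, j \in J -> F j (E j) & A = \bigcap_(j in [set` J]) E j]].

Lemma sub_pi_system_off (I : finType) (F : I -> set (set T)) (o j : I) :
  j != o -> F j `<=` pi_system_off F o.
Proof.
move=> jo A FA; exists [set j]%SET, (fun=> A); split.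
- by rewrite inE eq_sym.
- by move=> k; rewrite inE => /eqP ->.
- by apply/seteqP; split=> [x Ax k _//|x]; apply; rewrite /= inE.
Qed.

Lemma setI_closed_pi_system_off (I : finType) (F : I -> set (set T)) (o : I) :
  (forall j, setI_closed (F j)) -> (forall j, F j setT) ->
  setI_closed (pi_system_off F o).
Proof.
move=> FI FT _ _ [J [E [oJ FE ->]]] [J' [E' [oJ' FE' ->]]].
pose G j := if j \in J then E j else setT.
pose G' j := if j \in J' then E' j else setT.
exists (J :|: J')%SET, (fun j => G j `&` G' j); split.
- by rewrite inE negb_or oJ.
- move=> j _; apply: FI; rewrite /G /G'; case: ifPn => // jJ.
    exact: FE.
  exact: FE'.
- apply/seteqP; split=> [x [xJ xJ'] j _|x xJJ].
    split; [rewrite /G|rewrite /G']; case: ifPn => // jJ; first exact: xJ.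
    exact: xJ'.
  split=> j /= jJ.
    by have [] := xJJ j; rewrite /= ?inE ?jJ// /G jJ.
  by have [] := xJJ j; rewrite /= ?inE ?jJ ?orbT// /G' jJ.
Qed.

(** As functions of [A], the two sides are finite measures. They agree on the pi-system by
    independence of the sources in [J] together with [o], hence on the sigma-algebra it
    generates. *)
Lemma mutually_independent_off (I : finType) (F : I -> set (set T)) (o : I)
    (A B : set T) :
  (forall j, F j `<=` measurable) -> (forall j, setI_closed (F j)) ->
  (forall j, F j setT) -> mutually_independent P F ->
  <<s pi_system_off F o >> A -> F o B -> (P (A `&` B) = P A * P B)%E.
Proof.
move=> mF FI FT indep QA FB.
have mB := mF _ _ FB.
have mQ : pi_system_off F o `<=` measurable.
  move=> _ [J [E [_ FE ->]]]; apply: fin_bigcap_measurable; first exact: finite_finset.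
  by move=> j /= jJ; apply: mF; exact: FE.
pose m1 := mrestr P mB.
have PB0 : (0 <= fine (P B))%R by exact: fine_ge0.
pose m2 := mscale (NngNum PB0) P.
have PBE : (fine (P B))%:E = P B by rewrite fineK// fin_num_measure.
suff : m1 A = m2 A by rewrite /m1 /m2 /mrestr /mscale /= PBE muleC.
apply: (@g_sigma_algebra_measure_unique _ R T (pi_system_off F o) mQ (fun=> setT)) => //.
- move=> _; exists finset.set0, (fun=> setT); split; first by rewrite inE.
    by move=> j; rewrite inE.
  by apply/seteqP; split=> // x _ j /=; rewrite inE.
- by rewrite bigcup_const//; exists 0%N.
- exact: setI_closed_pi_system_off.
- move=> _ [J [E [oJ FE ->]]]; 
  change (P (\bigcap_(j in [set` J]) E j `&` B) =
    ((fine (P B))%:E * P (\bigcap_(j in [set` J]) E j))%E).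
  rewrite PBE muleC.
  pose E' j := if j == o then B else E j.
  have EJ j : j \in J -> E' j = E j.
    by move=> jJ; rewrite /E' ifN//; apply: contraNneq oJ => <-.
  have := indep (o |: J)%SET E'; rewrite big_setU1//= => indepJ.
  have E'o : E' o = B by rewrite /E' eqxx.
  rewrite E'o in indepJ.
  rewrite (eq_bigr (fun j => P (E j))) in indepJ; last by move=> j /EJ ->.
  rewrite (indep J)// muleC -indepJ.
    congr (P _); apply/seteqP; split=> [x [xJ xB] j|x xJ].
      by rewrite /= !inE /E'; case: eqP => // _ /= jJ; exact: xJ.
    split; last by have := xJ o; rewrite /= !inE eqxx /E' eqxx; exact.
    by move=> j /= jJ; rewrite -EJ//; apply: xJ; rewrite /= !inE jJ orbT.
  by move=> j; rewrite !inE /E'; case: eqP => [->//|_ /= jJ]; exact: FE.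
- move=> _; change (P (setT `&` B) < +oo)%E; rewrite setTI.
  by rewrite (le_lt_trans (probability_le1 P mB))// ltry.
Qed.

(** Independence makes the image under [X] of [P] restricted to [A] equal to [P A] times the
    distribution of [X]; [f] is integrated against both. *)
Lemma ge0_integral_indep d' (U : measurableType d') (A : set T)
    (X : {RV P >-> U}) (f : U -> R) :
  measurable A ->
  (forall E, measurable E -> (P (A `&` X @^-1` E) = P A * P (X @^-1` E))%E) ->
  measurable_fun [set: U] f -> (forall x, 0 <= f x) ->
  (\int[P]_(w in A) (f (X w))%:E = P A * \int[distribution P X]_x (f x)%:E)%E.
Proof.
move=> mA indep mf f0.
have mfE : measurable_fun [set: U] (EFin \o f) by exact/measurable_EFinP.
have PA0 : (0 <= fine (P A))%R by exact: fine_ge0.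
have PAE : (fine (P A))%:E = P A by rewrite fineK// fin_num_measure.
rewrite -PAE -[(fine (P A))]/((NngNum PA0)%:num).
rewrite -[RHS](ge0_integral_mscale _ measurableT)//=; last by move=> x _; rewrite lee_fin.
have mX : measurable_fun [set: T] X by [].
transitivity (\int[pushforward (mrestr P mA) X]_x (f x)%:E)%E.
  rewrite ge0_integral_pushforward//=; last by move=> x _; rewrite lee_fin.
  rewrite preimage_setT.
  have mrA : measurable_fun [set: T] (fun w => (f (X w))%:E).
    exact: measurableT_comp mfE mX.
  rewrite -[X in (_ = integral _ X _)%E](setUv A) ge0_integral_setU//=; last 4 first.
  - exact: measurableC.
  - by rewrite setUv.
  - by move=> w _; rewrite lee_fin.
  - exact/disj_setPCl.
  rewrite [X in (_ + X)%E]null_set_integral//; last 3 first.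
  - exact: measurableC.
  - exact: measurable_funTS.
  - by change (P (~` A `&` A) = 0%E); rewrite setICl measure0.
  rewrite adde0; apply: eq_measure_integral => B mB BA.
  by change (P B = P (B `&` A)); rewrite setIidl.
apply: eq_measure_integral => E mE _.
change (P (X @^-1` E `&` A) = ((fine (P A))%:E * P (X @^-1` E))%E).
by rewrite PAE setIC indep.
Qed.


Section Gaussian.
Variables (X : {RV P >-> R}) (m s : R).
Hypothesis s0 : s != 0.
Hypothesis XE : forall E, measurable E -> distribution P X E = normal_prob m s E.

(* normal_prob lives on measurableTypeR R, whose display is not the canonical
   one of R, so X is retyped before integrating against its distribution. *)
Let mXR : measurable_fun [set: T] (X : T -> measurableTypeR R).
Proof. exact: (measurable_funP X). Qed.

Let XR : {RV P >-> measurableTypeR R} :=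
  HB.pack (X : T -> measurableTypeR R) (isMeasurableFun.Build _ _ _ _ _ mXR).

Let integral_gauss (f : R -> R) : measurable_fun [set: measurableTypeR R] f ->
  (\int[distribution P XR]_x (f x)%:E = \int[normal_prob m s]_x (f x)%:E)%E.
Proof. by move=> mf; apply: eq_measure_integral => E mE _; exact: XE. Qed.

Let mpos : measurable_fun [set: measurableTypeR R] (fun x => Num.max (x - m) 0).
Proof. by apply: measurable_maxr => //; exact: measurable_funB. Qed.

Let mneg : measurable_fun [set: measurableTypeR R] (fun x => Num.max (- (x - m)) 0).
Proof.
by apply: measurable_maxr => //; apply: measurableT_comp => //; exact: measurable_funB.
Qed.

Let max_ge0 (x : R) : 0 <= Num.max x 0. Proof. by rewrite le_max lexx orbT. Qed.

Lemma integrable_gauss : P.-integrable [set: T] (EFin \o X).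
Proof.
have mX : measurable_fun [set: T] X by [].
have [eqpn ltp] := normal_prob_mean m s0.
suff iXm : P.-integrable [set: T] (EFin \o (fun w => X w - m)).
  rewrite (_ : _ \o _ = ((EFin \o (fun w => X w - m)%R) \+ cst m%:E)%E).
    by apply: integrableD => //; exact: finite_measure_integrable_cst.
  by apply/funext => w /=; rewrite -EFinD subrK.
apply/integrableP; split; first by apply/measurable_EFinP; exact: measurable_funB.
have mE (f : R -> R) : measurable_fun [set: measurableTypeR R] f ->
    measurable_fun [set: T] (fun w => (f (X w))%:E).
  by move=> mf; apply/measurable_EFinP; exact: measurableT_comp mf mXR.
have -> : (\int[P]_w `|(EFin \o (fun w => (X w - m)%R)) w| =
    \int[P]_w ((Num.max (X w - m) 0)%:E + (Num.max (- (X w - m)) 0)%:E))%E.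
  apply: eq_integral => w _ /=; rewrite -EFinD; congr (_%:E).
  have /orP[h|h] := le_total 0 (X w - m).
    by rewrite ger0_norm// max_l// max_r ?addr0// oppr_le0.
  by rewrite ler0_norm// max_r// max_l ?add0r// oppr_ge0.
rewrite ge0_integralD//=; last 4 first.
- by move=> w _; rewrite lee_fin.
- exact: (mE _ mpos).
- by move=> w _; rewrite lee_fin.
- exact: (mE _ mneg).
have eqX (f : R -> R) : measurable_fun [set: measurableTypeR R] f -> (forall x, 0 <= f x) ->
    (\int[P]_w (f (X w))%:E = \int[normal_prob m s]_x (f x)%:E)%E.
  move=> mf f0; rewrite -integral_gauss// ge0_integral_distribution//.
    exact/measurable_EFinP.
by rewrite (eqX _ mpos)// (eqX _ mneg)// -eqpn lte_add_pinfty.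
Qed.

(** Over a conditioning event [A], the positive and negative parts of [X - m] both integrate to
    [P A] times the same finite number, so they cancel. *)
Lemma is_cond_exp_indep_gauss (C : set (set T)) :
  C `<=` measurable ->
  (forall A E, <<s C >> A -> measurable E ->
    (P (A `&` X @^-1` E) = P A * P (X @^-1` E))%E) ->
  is_cond_exp P C (fun w => X w - m) (fun=> 0).
Proof.
move=> mC indep; have [eqpn ltp] := normal_prob_mean m s0.
have iXm : P.-integrable [set: T] (EFin \o (fun w => X w - m)).
  rewrite (_ : _ \o _ = ((EFin \o X) \- cst m%:E)%E); last first.
    by apply/funext => w /=; rewrite EFinB.
  by apply: integrableB => //; [exact: integrable_gauss|exact: finite_measure_integrable_cst].
split; first exact: measurable_cst.
exists (fun=> [set: T]); split=> //.
- by move=> _; exact: (@measurableT _ (g_sigma_algebraType C)).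
- by rewrite bigcup_const//; exists 0%N.
move=> _ A CA _; rewrite integral0 integralE.
have mA : measurable A := smallest_sub (@sigma_algebra_measurable _ T) mC CA.
have -> : (\int[P]_(w in A) ((fun w => (X w - m)%:E)^\+ w) =
   \int[P]_(w in A) (Num.max (X w - m) 0)%:E)%E.
  by apply: eq_integral => w _; rewrite funeposE EFin_max.
have -> : (\int[P]_(w in A) ((fun w => (X w - m)%:E)^\- w) =
   \int[P]_(w in A) (Num.max (- (X w - m)) 0)%:E)%E.
  by apply: eq_integral => w _; rewrite funenegE EFin_max.
rewrite (@ge0_integral_indep _ _ A XR (fun x => Num.max (x - m) 0))//;
  last by move=> E; exact: indep.
rewrite (@ge0_integral_indep _ _ A XR (fun x => Num.max (- (x - m)) 0))//;
  last by move=> E; exact: indep.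
rewrite !integral_gauss// -eqpn subee// fin_numM// ?fin_num_measure//.
by rewrite ge0_fin_numE// integral_ge0// => x _; rewrite lee_fin.
Qed.

End Gaussian.

End Independence.

(** * Measurability of determinants and inverse matrices *)

Section MeasurableMatrix.
Context d (U : measurableType d) (R : realType).

Lemma measurable_fun_fin (B : finType) (f : U -> B) (g : B -> U -> R) :
  (forall b, measurable (f @^-1` [set b])) ->
  (forall b, measurable_fun [set: U] (g b)) ->
  measurable_fun [set: U] (fun u => g (f u) u).
Proof.
move=> mf mg _ E mE; rewrite setTI.
rewrite (_ : _ @^-1` E = \bigcup_(b in [set: B]) (f @^-1` [set b] `&` g b @^-1` E)).
  apply: fin_bigcup_measurable; first exact: finite_finset.
  by move=> b _; apply: measurableI => //; rewrite -[X in measurable X]setTI; exact: mg.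
by apply/seteqP; split=> [u Eu|u [b _ [/= <-]]//]; exists (f u).
Qed.

(* Over the reals x^-1 = x (x^2)^-1, also at 0 since 0^-1 = 0; this reduces to powR. *)
Lemma measurable_fun_inv (f : U -> R) :
  measurable_fun [set: U] f -> measurable_fun [set: U] (fun u => (f u)^-1).
Proof.
move=> mf.
rewrite (_ : (fun _ => _) = (fun u => f u * ((f u) ^+ 2) `^ (-1))).
  apply: measurable_funM => //.
  by apply: (measurableT_comp (measurable_powR _)); exact: measurable_funX.
apply/funext => u; rewrite powR_inv1 ?sqr_ge0//.
have [->|f0] := eqVneq (f u) 0; first by rewrite mul0r invr0.
by field.
Qed.

Lemma measurable_fun_det n (M : U -> 'M[R]_n) :
  (forall i j, measurable_fun [set: U] (fun u => M u i j)) ->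
  measurable_fun [set: U] (fun u => \det (M u)).
Proof.
move=> mM; apply: measurable_sum => s.
apply: measurable_funM => //; apply: measurable_prod => i _; exact: mM.
Qed.

Lemma measurable_fun_invmx n (M : U -> 'M[R]_n) i j :
  (forall i j, measurable_fun [set: U] (fun u => M u i j)) ->
  measurable_fun [set: U] (fun u => invmx (M u) i j).
Proof.
move=> mM; have mdet := measurable_fun_det mM.
(* By convention [invmx] returns a singular matrix unchanged; elsewhere it is the adjugate over the
   determinant. *)
rewrite (_ : (fun _ => _) = (fun u => if \det (M u) == 0 then M u i j
    else (\det (M u))^-1 * cofactor (M u) j i)); last first.
  apply/funext => u; rewrite /invmx unitmxE unitfE; case: eqP => //= _.
  by rewrite !mxE.
apply: measurable_fun_ifT => //.
- apply: (@measurable_fun_bool _ _ _ _ true).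
  rewrite setTI (_ : _ @^-1` _ = (fun u => \det (M u)) @^-1` [set 0]).
    by rewrite -[X in measurable X]setTI; exact: mdet.
  by apply/seteqP; split=> u /= /eqP.
- apply: measurable_funM; first exact: measurable_fun_inv.
  apply: measurable_funM => //; apply: measurable_fun_det => k l.
  by under eq_fun do rewrite !mxE; exact: mM.
Qed.

End MeasurableMatrix.

(** * Linear structural equations on an acyclic graph *)

Section AcyclicSEM.
Context {R : realType} {N : nat}.
Implicit Types (W : 'M[R]_N) (S : {set 'I_N}).

(** The rank counts ancestors, the node itself included. It increases strictly along an edge from
    [k] to [j], because [j] being an ancestor of [k] would close a cycle. *)
Lemma acyclic_rank (V : finType) (e : rel V) : acyclic e ->
  exists r : V -> nat, forall k j, e k j -> (r k < r j)%N.
Proof.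
move=> ace; exists (fun j => #|[set k | connect e k j]%SET|) => k j ekj.
apply: proper_card; apply/properP; split.
  apply/fintype.subsetP => l; rewrite !inE => /connect_trans; apply; exact: connect1.
exists j; rewrite !inE ?connect0//; apply/negP => /connectP[p pp kE].
by have := ace (j :: p) isT; rewrite /= rcons_path pp -kE ekj.
Qed.

(** Induction on the rank: since [S] is closed under parents, the equation at [j] involves only
    nodes of [S] of smaller rank. *)
Lemma sem_homogeneous_eq0 W S (v : 'I_N -> R) : acyclic (edge W) ->
  (forall j k, j \in S -> edge W k j -> k \in S) ->
  (forall j, j \in S -> v j = \sum_k W k j * v k) ->
  forall j, j \in S -> v j = 0.
Proof.
move=> /acyclic_rank[r rW] SW vS j; have [n] := ubnP (r j).
elim: n j => // n IHn j jn jS; rewrite vS// big1// => k _.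
have [->|Wkj] := eqVneq (W k j) 0; first by rewrite mul0r.
by rewrite IHn ?mulr0//; [exact: leq_trans (rW _ _ Wkj) _|exact: SW Wkj].
Qed.

Lemma sem_unitmx W : acyclic (edge W) -> 1%:M - W^T \in unitmx.
Proof.
move=> acW; rewrite -unitmx_tr -row_free_unit linearB/= trmx1 trmxK.
apply: inj_row_free => u; rewrite mulmxBr mulmx1 => /eqP; rewrite subr_eq0 => /eqP uW.
apply/rowP => j; rewrite mxE.
apply: (@sem_homogeneous_eq0 W [set: 'I_N]%SET (fun k => u 0 k)) => //;
  try by move=> *; rewrite inE.
move=> l _.
by rewrite [in LHS]uW mxE; apply: eq_bigr => k _; rewrite mulrC.
Qed.

Lemma sem_solution W (x e : 'cV[R]_N) : acyclic (edge W) ->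
  x = W^T *m x + e -> x = invmx (1%:M - W^T) *m e.
Proof.
move=> acW xE; have -> : e = (1%:M - W^T) *m x.
  by rewrite mulmxBl mul1mx [in X in X - _]xE addrC addKr.
by rewrite mulKmx// sem_unitmx.
Qed.

(** Entry [(k, i)] of the inverse is the total effect on node [k] of the exogenous variable of [i];
    it vanishes when no path leads from [i] to [k]. *)
Lemma sem_nondescendant W i S k :
  acyclic (edge W) -> acyclic (set_parents W i S) -> k \in S ->
  invmx (1%:M - W^T) k i = 0.
Proof.
move=> acW acS kS; pose e := set_parents W i S.
(* Nodes with a path to S: closed under parents, and without i, so that column i
   of the inverse solves the homogeneous equations there. *)
pose anc := [set j | [exists s in S, connect e j s]]%SET.
have iNanc : i \notin anc.
  (* A path from [i] to a node of [S] would close up with the edge back to [i] given by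
     [set_parents]. *)
  rewrite inE; apply/existsP => -[s /andP[sS /connectP[p pp sE]]].
  have := acS (i :: p) isT; rewrite /= rcons_path pp -sE /=.
  by rewrite /set_parents eqxx sS.
set A := invmx _.
have AE : A = W^T *m A + 1%:M.
  rewrite -(mulmxV (sem_unitmx acW)) mulmxBl mul1mx.
  by rewrite addrC subrK.
apply: (@sem_homogeneous_eq0 W anc (fun j => A j i)) => //.
- move=> j l; rewrite !inE => /existsP[s /andP[sS js]] Wlj.
  apply/existsP; exists s; rewrite sS /=; apply: (connect_trans _ js).
  apply: connect1; rewrite /e /set_parents ifN//.
  apply: contraNneq iNanc => <-; rewrite inE; apply/existsP; exists s.
  by rewrite sS js.
- move=> j jS; rewrite [in LHS]AE !mxE (_ : (j == i) = false) ?addr0.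
    by apply: eq_bigr => l _; rewrite mxE.
  by apply: contraNF iNanc => /eqP <-.
- by rewrite inE; apply/existsP; exists k; rewrite kS connect0.
Qed.

End AcyclicSEM.

Lemma sum_enum_val (V : nmodType) (I : finType) (A : {set I}) (F : I -> V) :
  \sum_(j < #|A|) F (enum_val j) = \sum_i if i \in A then F i else 0.
Proof. by rewrite -big_mkcond [RHS]big_enum_val. Qed.

(** * Observations and conditioning data in the model *)

Section Model.
Context d (T : measurableType d) (R : realType) (P : probability T R) (N t : nat).
Variables (B B' : 'M[R]_N) (nu sigma : 'I_N -> R).
Variables (act : 'I_t -> 'I_N -> {RV P >-> bool}).
Variables (eps : 'I_t -> 'I_N -> {RV P >-> R}) (X : T -> 'M[R]_(N, t)).
Hypothesis sem : linear_sem B B' nu sigma act eps X.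

Local Notation source := (source_sigma act eps).

(** A finite function, so that interventions range over a [finType] and [measurable_fun_fin]
    applies. *)
Let interv tau (w : T) : {ffun 'I_N -> bool} := [ffun k => act tau k w].

Let mixing (b : {ffun 'I_N -> bool}) : 'M[R]_N :=
  invmx (1%:M - (post_intervention B B' b)^T).

Let obsE w k tau : X w k tau = \sum_j mixing (interv tau w) k j * eps tau j w.
Proof.
case: sem => ac _ _ _ /(_ tau w) xE.
have -> : X w k tau = col tau (X w) k 0 by rewrite mxE.
rewrite (sem_solution (ac _) xE) mxE; apply: eq_bigr => j _.
rewrite mxE /mixing; congr (invmx (1%:M - _^T) _ _ * _).
by apply/matrixP => k' j'; rewrite !mxE ffunE.
Qed.

Lemma source_sigma_measurable o : source o `<=` measurable.
Proof.
case: o => [[tau k]|] /=.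
  by move=> _ [E mE <-]; exact: (measurable_funP (eps tau k)).
apply: (smallest_sub (@sigma_algebra_measurable _ T)) => _ [tau [k [E ->]]].
by rewrite -[X in measurable X]setTI; exact: (measurable_funP (act tau k)).
Qed.

Lemma setI_closed_source_sigma o : setI_closed (source o).
Proof.
case: o => [[tau k]|] /=.
  move=> _ _ [E mE <-] [E' mE' <-]; exists (E `&` E'); first exact: measurableI.
  by rewrite !setTI preimage_setI.
by move=> E E' sE sE'; exact: (@measurableI _ (g_sigma_algebraType _)).
Qed.

Lemma source_sigmaT o : source o setT.
Proof.
case: o => [[tau k]|] /=; first by exists setT; rewrite ?setTI ?preimage_setT.
exact: (@measurableT _ (g_sigma_algebraType _)).
Qed.

Let source_interv tau b : source None (interv tau @^-1` [set b]).
Proof.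
rewrite (_ : _ @^-1` _ = \bigcap_(k in [set: 'I_N]) (act tau k @^-1` [set b k])).
  apply: (@fin_bigcap_measurable _ (g_sigma_algebraType _)).
    exact: finite_finset.
  by move=> k _; apply: sub_sigma_algebra; exists tau, k, [set b k].
apply/seteqP; split=> [w /= <- k _ /=|w bw /=]; first by rewrite ffunE.
by apply/ffunP => k; rewrite ffunE; exact: bw.
Qed.

Let measurable_interv tau b : measurable (interv tau @^-1` [set b]).
Proof. by apply: (@source_sigma_measurable None); exact: source_interv. Qed.

Lemma measurable_obs k tau : measurable_fun [set: T] (fun w => X w k tau).
Proof.
under eq_fun do rewrite obsE.
apply: (@measurable_fun_fin _ _ _ _ (interv tau)
  (fun b w => \sum_j mixing b k j * eps tau j w)); first exact: measurable_interv.
by move=> b; apply: measurable_sum => j; apply: measurable_funM.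
Qed.

Lemma integrable_obs k tau : P.-integrable [set: T] (fun w => (X w k tau)%:E).
Proof.
have [_ sg0 epsE _ _] := sem.
rewrite (_ : (fun _ => _) = (fun w => (\sum_b \sum_j
    (\1_(interv tau @^-1` [set b]) w * mixing b k j * eps tau j w)%:E)%E)); last first.
  apply/funext => w; rewrite obsE.
  under [RHS]eq_bigr do rewrite sumEFin.
  rewrite sumEFin (bigD1 (interv tau w))//= [X in _ + X]big1 ?addr0.
    by congr _%:E; apply: eq_bigr => j _; rewrite indicE mem_set// mul1r.
  move=> b bw; apply: big1 => j _; rewrite indicE memNset ?mul0r//.
  by move=> /= wb; rewrite wb eqxx in bw.
apply: integrable_sum => // b _; apply: integrable_sum => // j _.
apply: (@integrable_bounded_mul _ _ _ P _ _ _ `|mixing b k j|) => //.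
- apply: (@integrable_gauss _ _ _ _ _ (nu j) (sigma j)); first by rewrite gt_eqF.
  exact: epsE.
- apply: measurable_funTS; apply: measurable_funM => //.
- move=> w _; rewrite normrM ler_piMl// indicE.
  by case: (_ \in _); rewrite ?normr1 ?normr0.
Qed.

Variables (i : 'I_N) (a : 'I_N -> bool) (S : {set 'I_N}).
Let D := steps act i (a i).
Let G := data_events X S D.

Lemma measurable_data_events : G `<=` measurable.
Proof.
move=> _ [k [tau [E [kS mE ->]]]].
rewrite (_ : [set w | _] = (act tau i @^-1` [set a i]) `&`
    ((fun w => X w k tau) @^-1` E)); last first.
  apply/seteqP; split=> w /=; rewrite /D inE => -[].
    by move=> /eqP.
  by move=> ->; rewrite eqxx.
apply: measurableI; last by rewrite -[X in measurable X]setTI; exact: measurable_obs.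
by rewrite -[X in measurable X]setTI; exact: (measurable_funP (act tau i)).
Qed.

(* The entries of data (X w) S (D w), extended by 0 to the steps that are not
   selected: the dimensions of that matrix depend on w, those of masked do not. *)
Definition masked k tau w : R := if tau \in D w then X w k tau else 0.

Lemma measurable_masked_gen k tau : k \in S ->
  measurable_fun [set: g_sigma_algebraType G] (masked k tau : g_sigma_algebraType G -> R).
Proof.
move=> kS _ E mE; rewrite setTI.
pose ev E := [set w | tau \in D w /\ E (X w k tau)].
have mev E' : measurable E' -> @measurable _ (g_sigma_algebraType G) (ev E').
  by move=> mE'; apply: sub_sigma_algebra; exists k, tau, E'.
(* An unselected step has masked value 0. When [E] contains 0, the preimage therefore includes the
   complement of [ev setT], where [tau] is not selected. *)
have [E0|E0] := pselect (E 0).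
  rewrite (_ : _ @^-1` _ = ev E `|` ~` ev setT); last first.
    apply/seteqP; split=> w; rewrite /ev /masked /=.
      by case: ifPn => [tD Ew|tD _]; [left|right => -[]].
    case: ifPn => [_ [[]//|/not_andP[]//]|_ _]; last by [].
  by apply: measurableU; [exact: mev|apply: measurableC; exact: mev].
rewrite (_ : _ @^-1` _ = ev E); first exact: mev.
apply/seteqP; split=> w; rewrite /ev /masked /=; case: ifPn => //= _;
  first [by case|by move/E0].
Qed.

(** Selecting a step fixes the status of node [i] alone, so every intervention agreeing with [a] at
    [i] can occur there. *)
Hypothesis acS : forall b : 'I_N -> bool, b i = a i ->
  acyclic (set_parents (post_intervention B B' b) i S).

(** [tau0] is arbitrary because the noise of node [i] is removed from the data at all steps, not
    only at [tau0]. *)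
Lemma data_events_off tau0 :
  <<s G >> `<=` <<s pi_system_off source (Some (tau0, i)) >>.
Proof.
set Q := pi_system_off _ _; pose TQ := g_sigma_algebraType Q.
have sQ o : o != Some (tau0, i) -> source o `<=` <<s Q >>.
  move=> oi E oE; apply: sub_sigma_algebra; exact: sub_pi_system_off oE.
apply: (smallest_sub (@sigma_algebra_measurable _ TQ)).
move=> _ [k [tau [E [kS mE ->]]]].
(* On the selected steps, X k tau without the contribution of node i, which
   vanishes because k is not a descendant of i. *)
pose Y w := \sum_j (if j == i then 0 else mixing (interv tau w) k j * eps tau j w).
have mY : measurable_fun [set: TQ] (Y : TQ -> R).
  apply: (@measurable_fun_fin _ TQ R _ (interv tau : TQ -> _)
    (fun b w => \sum_j (if j == i then 0 else mixing b k j * eps tau j w))).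
    by move=> b; apply: (sQ None) => //; exact: source_interv.
  move=> b; apply: (@measurable_sum _ TQ) => j; case: eqP => [_|/eqP ji].
    exact: measurable_cst.
  apply: measurable_funM; first exact: measurable_cst.
  move=> _ F mF; rewrite setTI; apply: (sQ (Some (tau, j))).
    by apply: contra ji => /eqP[_ ->].
  by exists F; rewrite ?setTI.
rewrite (_ : [set w | _] = (act tau i @^-1` [set a i]) `&` (Y @^-1` E)).
  apply: (@measurableI _ TQ).
    by apply: (sQ None) => //; apply: sub_sigma_algebra; exists tau, i, [set a i].
  by rewrite -[X in measurable X]setTI; exact: mY.
have XY w : act tau i w = a i -> X w k tau = Y w.
  move=> ai; rewrite obsE /Y; apply: eq_bigr => j _; case: eqP => // ->.
  rewrite /mixing (sem_nondescendant _ (acS _) kS) ?mul0r//.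
    by case: sem.
  by rewrite ffunE.
apply/seteqP; split=> w /=; rewrite /D inE => -[].
  by move=> /eqP ai; rewrite -XY.
by move=> ai; rewrite XY// ai eqxx.
Qed.

Lemma cond_exp_noise tau :
  is_cond_exp P G (fun w => eps tau i w - nu i) (fun=> 0).
Proof.
have [_ sg0 epsE indep _] := sem.
apply: (@is_cond_exp_indep_gauss _ _ _ _ _ (nu i) (sigma i)).
- by rewrite gt_eqF.
- exact: epsE.
- exact: measurable_data_events.
- move=> A E GA mE.
  apply: (mutually_independent_off source_sigma_measurable setI_closed_source_sigma
    source_sigmaT indep (data_events_off (tau0 := tau) GA)).
  by exists E; rewrite ?setTI.
Qed.


(** * Entrywise expansion of the estimator and its conditional expectation *)

Lemma gramE w p q : gram (X w) S (D w) p q =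
  \sum_tau masked (enum_val p) tau w * masked (enum_val q) tau w.
Proof.
rewrite mxE (eq_bigr (fun q0 : 'I_#|D w| => X w (enum_val p) (enum_val q0) *
  X w (enum_val q) (enum_val q0))); last by move=> j _; rewrite !mxE.
rewrite (sum_enum_val (D w) (fun tau => X w (enum_val p) tau * X w (enum_val q) tau)).
apply: eq_bigr => tau _; rewrite /masked.
by case: ifP; rewrite ?mul0r.
Qed.

(** A single mask already discards the unselected steps. With the other factor left bare, the masked
    one can be pulled out of the conditional expectation of a plain, integrable observation. *)
Lemma crossE (S' : {set 'I_N}) w p q :
  (data (X w) S (D w) *m (data (X w) S' (D w))^T) p q =
  \sum_tau masked (enum_val p) tau w * X w (enum_val q) tau.
Proof.
rewrite mxE (eq_bigr (fun q0 : 'I_#|D w| => X w (enum_val p) (enum_val q0) *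
  X w (enum_val q) (enum_val q0))); last by move=> j _; rewrite !mxE.
rewrite (sum_enum_val (D w) (fun tau => X w (enum_val p) tau * X w (enum_val q) tau)).
apply: eq_bigr => tau _; rewrite /masked.
by case: ifP; rewrite ?mul0r.
Qed.

Let invg w := invmx (gram (X w) S (D w)).

Lemma measurable_gram_gen p q :
  measurable_fun [set: g_sigma_algebraType G]
    ((fun w => gram (X w) S (D w) p q) : g_sigma_algebraType G -> R).
Proof.
under eq_fun do rewrite gramE.
apply: (@measurable_sum _ (g_sigma_algebraType G)) => tau.
by apply: measurable_funM; apply: measurable_masked_gen; exact: enum_valP.
Qed.

Let measurable_invg p q :
  measurable_fun [set: g_sigma_algebraType G]
    ((fun w => invg w p q) : g_sigma_algebraType G -> R).
Proof.
apply: (@measurable_fun_invmx _ (g_sigma_algebraType G)) => k l.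
exact: measurable_gram_gen.
Qed.

Lemma cond_exp_cross_exists (S' : {set 'I_N}) : exists M,
  is_cond_exp_mx P G
    (fun w => data (X w) S (D w) *m (data (X w) S' (D w))^T) M.
Proof.
have ex l tau : exists Y, is_cond_exp P G (fun w => X w l tau) Y.
  by apply: (cond_exp_exists measurable_data_events); exact: integrable_obs.
have /choice[Y YE] : forall lt : 'I_N * 'I_t, exists Y,
  is_cond_exp P G (fun w => X w lt.1 lt.2) Y by move=> lt; exact: ex.
exists (fun w => \matrix_(p, q) \sum_tau
  masked (enum_val p) tau w * Y (enum_val q, tau) w) => p q.
under eq_fun do rewrite crossE.
under [X in is_cond_exp _ _ _ X]eq_fun do rewrite mxE.
apply: (is_cond_exp_sum measurable_data_events) => tau.
apply: (is_cond_expM measurable_data_events); first exact: (YE (enum_val q, tau)).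
by apply: measurable_masked_gen; exact: enum_valP.
Qed.

Let Ba := post_intervention B B' a.
Let miss := (parents Ba i :\: S)%SET.

Let noise w : 'cV[R]_#|D w| := \col_q (eps (enum_val q) i w - nu i).

(** Nodes of [S] that are not parents have weight 0, and [miss] collects the parents outside [S], so
    the two products add up to the full structural sum. *)
Lemma node_dataE w :
  (node_data (X w) i (D w) - const_mx (nu i))^T =
  (data (X w) S (D w))^T *m weights_into Ba i S +
  (data (X w) miss (D w))^T *m weights_into Ba i miss + noise w.
Proof.
case: sem => _ _ _ _ xE; apply/colP => q; set tau := enum_val q.
have ai : act tau i w = a i.
  by have := enum_valP q; rewrite /D inE => /eqP.
have XE : X w i tau = \sum_k Ba k i * X w k tau + eps tau i w.
  have := congr1 (fun M : 'cV_N => M i 0) (xE tau w); rewrite !mxE => ->.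
  by congr (_ + _); apply: eq_bigr => k _; rewrite !mxE ai.
have dE (S' : {set 'I_N}) : ((data (X w) S' (D w))^T *m weights_into Ba i S') q 0 =
    \sum_k if k \in S' then Ba k i * X w k tau else 0.
  rewrite -(sum_enum_val S' (fun k => Ba k i * X w k tau)) mxE.
  by apply: eq_bigr => j _; rewrite [weights_into _ _ _ _ _]mxE !mxE mulrC.
have addE (u v : 'cV[R]_#|D w|) : (u + v) q 0 = u q 0 + v q 0 by rewrite mxE.
rewrite !addE !dE !mxE -/tau XE addrA; congr (_ + _ - _).
rewrite -big_split/=; apply: eq_bigr => k _.
rewrite !inE /edge; case: (k \in S) => /=; first by rewrite addr0.
by rewrite add0r; case: eqP => //= ->; rewrite mul0r.
Qed.

(** Coefficient of the noise at step [tau]. Being 0 on unselected steps, it turns the noise term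
    into a sum over a fixed index set. *)
Let gain w p tau := \sum_r invg w p r * masked (enum_val r) tau w.

Lemma mmseE w p q : mmse nu (X w) i S (D w) p q =
  \sum_r (invg w *m gram (X w) S (D w)) p r * Ba (enum_val r) i +
  \sum_s \sum_r (invg w p r * Ba (enum_val s) i) *
    (data (X w) S (D w) *m (data (X w) miss (D w))^T) r s +
  \sum_tau gain w p tau * (eps tau i w - nu i).
Proof.
rewrite /mmse node_dataE !mulmxDr -/(invg w) mxE [in X in X + _ = _]mxE.
congr (_ + _ + _).
- rewrite -!mulmxA (mulmxA _ _^T) -/(gram _ _ _) mulmxA mxE.
  by apply: eq_bigr => r _; rewrite [weights_into _ _ _ _ _]mxE.
- rewrite -!mulmxA (mulmxA _ _^T) mulmxA mxE.
  apply: eq_bigr => s _; rewrite mxE mulr_suml; apply: eq_bigr => r _.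
  by rewrite [weights_into _ _ _ _ _]mxE mulrAC.
- rewrite mxE; under eq_bigr do rewrite [noise _ _ _]mxE.
  have gE (j : 'I_#|D w|) : (invg w *m data (X w) S (D w)) p j = gain w p (enum_val j).
    rewrite mxE /gain; apply: eq_bigr => r _; rewrite !mxE /masked.
    by rewrite (enum_valP j).
  under eq_bigr do rewrite gE.
  rewrite (sum_enum_val (D w) (fun tau => gain w p tau * (eps tau i w - nu i))).
  apply: eq_bigr => tau _; case: ifPn => // tD.
  by rewrite /gain big1 ?mul0r// => r _; rewrite /masked (negbTE tD) mulr0.
Qed.

(** Covers false positives and false negatives together; each part of the theorem specializes
    [S]. *)
Lemma mmse_cond_exp M :
  {ae P, forall w, gram (X w) S (D w) \in unitmx} ->
  is_cond_exp_mx P G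
    (fun w => data (X w) S (D w) *m (data (X w) miss (D w))^T) M ->
  is_cond_exp_mx P G (fun w => mmse nu (X w) i S (D w))
    (fun w => weights_into Ba i S + invg w *m M w *m weights_into Ba i miss).
Proof.
move=> unitG CM p q; have mG := measurable_data_events.
under eq_fun do rewrite mmseE.
have tE w : (weights_into Ba i S + invg w *m M w *m weights_into Ba i miss) p q =
    Ba (enum_val p) i +
    \sum_s \sum_r (invg w p r * Ba (enum_val s) i) * M w r s +
    \sum_tau gain w p tau * 0.
  rewrite [X in _ = _ + X]big1; last by move=> *; rewrite mulr0.
  rewrite addr0 mxE [weights_into _ _ _ _ _]mxE; congr (_ + _).
  rewrite mxE; apply: eq_bigr => s _; rewrite mxE mulr_suml; apply: eq_bigr => r _.
  by rewrite [weights_into _ _ _ _ _]mxE mulrAC.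
under [X in is_cond_exp _ _ _ X]eq_fun do rewrite tE.
apply: (is_cond_expD mG); first apply: (is_cond_expD mG).
- apply: (is_cond_exp_ae mG).
  + apply: measurable_sum => r; apply: measurable_funM => //.
    under eq_fun do rewrite mxE.
    apply: measurable_sum => s; apply: measurable_funM.
      by move=> _ E mE; apply: (smallest_sub (@sigma_algebra_measurable _ T) mG);
        exact: measurable_invg.
    by move=> _ E mE; apply: (smallest_sub (@sigma_algebra_measurable _ T) mG);
        exact: measurable_gram_gen.
  + exact: measurable_cst.
  (* Where the Gram matrix is invertible, the first sum of [mmseE] reduces to the weight indexed by
     [p]. *)
  + apply: filterS unitG => w uG; rewrite /invg mulVmx// (bigD1 p)//= mxE eqxx mul1r.
    rewrite big1 ?addr0// => r rp.
    by rewrite mxE eq_sym (negbTE rp) mul0r.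
- apply: (is_cond_exp_sum mG) => s; apply: (is_cond_exp_sum mG) => r.
  apply: (is_cond_expM mG); first exact: CM.
  by apply: measurable_funM => //; exact: measurable_invg.
- apply: (is_cond_exp_sum mG) => tau.
  apply: (is_cond_expM mG); first exact: cond_exp_noise.
  apply: (@measurable_sum _ (g_sigma_algebraType G)) => r.
  apply: measurable_funM; first exact: measurable_invg.
  by apply: measurable_masked_gen; exact: enum_valP.
Qed.

End Model.

Theorem proposition3 (d : measure_display) (T : measurableType d)
    (R : realType) (P : probability T R) (N t : nat)
    (B B' : 'M[R]_N) (nu sigma : 'I_N -> R)
    (act : 'I_t -> 'I_N -> {RV P >-> bool})
    (eps : 'I_t -> 'I_N -> {RV P >-> R})
    (X : T -> 'M[R]_(N, t))
    (i : 'I_N) (a : 'I_N -> bool) (Phat : {set 'I_N}) :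
  let Ba := post_intervention B B' a in
  let Pa := parents Ba i in
  let D := steps act i (a i) in
  let Z := fun w => data (X w) Phat (D w) in
  let Bhat := fun w => mmse nu (X w) i Phat (D w) in
  let G := data_events X Phat D in
  linear_sem B B' nu sigma act eps X ->
  {ae P, forall w, Z w *m (Z w)^T \in unitmx} ->
  (Pa \subset Phat ->
   (forall b : 'I_N -> bool, b i = a i ->
      acyclic (set_parents (post_intervention B B' b) i Phat)) ->
   is_cond_exp_mx P G Bhat (fun _ => weights_into Ba i Phat))
  /\
  (Phat \subset Pa ->
   let C := fun w => Z w *m (data (X w) (Pa :\: Phat)%SET (D w))^T in
   (exists M, is_cond_exp_mx P G C M) /\
   (forall M, is_cond_exp_mx P G C M ->
      is_cond_exp_mx P G Bhat
        (fun w => weights_into Ba i Phat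
           + invmx (Z w *m (Z w)^T) *m M w
               *m weights_into Ba i (Pa :\: Phat)%SET))).
Proof.
move=> Ba Pa D Z Bhat G sem unitG; split=> [PaS acS|SPa C].
  have miss0 : #|(Pa :\: Phat)%SET| = 0%N.
    by apply/eqP; rewrite cards_eq0 finset.setD_eq0.
  (* The cross moment has no columns, so the zero matrix is vacuously a version of its conditional
     expectation. *)
  have no_miss (s : 'I_#|(Pa :\: Phat)%SET|) : False.
    by case: s => s; rewrite miss0.
  have := mmse_cond_exp sem acS unitG (M := fun=> 0).
  rewrite (_ : (fun w => _ + _) = (fun=> weights_into Ba i Phat)).
    by apply => p s; case: (no_miss s).
  by apply/funext => w; rewrite mulmx0 mul0mx addr0.
split; first exact: (cond_exp_cross_exists sem).
(* Since [Phat] lies inside the true parents, each edge of the modified graph is an edge of the true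
   graph under [b], whose acyclicity it inherits. *)
move=> M CM; apply: (mmse_cond_exp sem) => // b bi k k0.
have [ac _ _ _ _] := sem.
apply: contra (ac b k k0); apply: sub_cycle => l j.
rewrite /set_parents; case: eqP => // -> /(fintype.subsetP SPa).
by rewrite inE /edge !mxE bi.
Qed.
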